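(* Let $X$ be a separable infinite dimensional Banach space over $\mathbb{C}$ and let $S\in\mathcal{B}(X)$ be such that the generalised kernel $\mathcal{N}^\infty(S)=\bigcup_{n=1}^\infty \ker(S^n)$ is dense in $X$. Then $S$ lies in the operator norm closure of the set of generalised backward $1$-shifts on $X$, and consequently, for each $\lambda\in\mathbb{C}$ with $|\lambda|=1$, the operator $\lambda I+S$ lies in the operator norm closure of the set of mixing operators on $X$.
   Context: $\mathcal{B}(X)$ denotes the bounded linear operators on $X$; $I$ is the identity operator. An operator $T\in\mathcal{B}(X)$ is mixing if for each pair $U,V$ of nonempty open subsets of $X$ there is $N$ such that $T^n(U)\cap V\neq\emptyset$ for all $n>N$. An operator $B\in\mathcal{B}(X)$ is a generalised backward $1$-shift on $X$ if there is a linearly independent sequence $(x_k)_{k=1}^\infty$ in $X$ whose linear span is dense in $X$ (not necessarily a Schauder basis) such that for each $k\geq 1$ one has $Bx_k=\sum_{i=1}^{k-1}a^{k}_i x_i$ for some scalars $a^k_i\in\mathbb{C}$, with $a^k_{k-1}\neq 0$ whenever $k>1$ (so $Bx_1=0$). *)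

(* Defs.v *)
From HB Require Import structures.
From mathcomp Require Import all_boot all_order all_algebra.
From mathcomp Require Import complex.
From mathcomp Require Import all_classical all_reals all_analysis.

Set Implicit Arguments.
Unset Strict Implicit.
Unset Printing Implicit Defensive.

Import Order.TTheory GRing.Theory Num.Theory.
Import numFieldNormedType.Exports.

Local Open Scope classical_set_scope.
Local Open Scope ring_scope.
Local Open Scope complex_scope.

Definition separable_space (T : topologicalType) : Prop :=
  exists D : set T, countable D /\ dense D.

Definition linear_span (K : pzRingType) (V : lmodType K) (A : set V) : set V :=
  [set x | exists (n : nat) (c : 'I_n -> K) (v : 'I_n -> V),
     (forall i, A (v i)) /\ x = \sum_(i < n) c i *: v i].

Definition infinite_dimensional (K : pzRingType) (V : lmodType K) : Prop :=
  ~ exists A : set V, finite_set A /\ linear_span A = setT.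

Definition linearly_independent (K : pzRingType) (V : lmodType K)
    (x : nat -> V) : Prop :=
  forall (n : nat) (c : 'I_n -> K),
    \sum_(i < n) c i *: x i = 0 -> forall i, c i = 0.

Section Operators.
Context {R : realType} {X : normedModType R[i]}.

(* By [linear_boundedP] this is the existence of M with |T x| <= M |x|. *)
Definition bounded_operator (T : {linear X -> X}) : Prop :=
  bounded_near T (nbhs (0 : X)).

(* The norm of X takes its values in R[i], where it is a nonnegative real,
   hence the projection Re. [sup] is the true supremum only for a bounded T. *)
Definition operator_norm (T : X -> X) : R :=
  sup [set complex.Re `|T x| | x in [set x : X | `|x| <= 1]].

(* Closure, taken in the bounded operators, for the operator norm distance. *)
Definition operator_norm_closure (A : set {linear X -> X}) :
    set {linear X -> X} :=
  [set T | bounded_operator T /\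
     forall e : R, 0 < e ->
       exists B : {linear X -> X},
         [/\ bounded_operator B, A B & operator_norm (T \- B) < e]].

Definition generalised_kernel (T : X -> X) : set X :=
  \bigcup_(n in [set n : nat | (1 <= n)%N]) [set x | iter n T x = 0].

Definition mixing (T : X -> X) : Prop :=
  forall U V : set X, open U -> open V -> U !=set0 -> V !=set0 ->
    exists N : nat, forall n : nat, (N < n)%N ->
      (iter n T @` U) `&` V !=set0.

Definition mixing_operator : set {linear X -> X} :=
  [set T | bounded_operator T /\ mixing T].

(* Sequences start at 0: [x k] is the usual x_(k+1) and [a k i] is
   a^(k+1)_(i+1); the empty sum gives [B (x 0) = 0]. *)
Definition generalised_backward_1_shift : set {linear X -> X} :=
  [set B | bounded_operator B /\
     exists x : nat -> X,
       [/\ linearly_independent x,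
           dense (linear_span (range x)) &
           exists a : nat -> nat -> R[i], forall k : nat,
             B (x k) = \sum_(i < k) a k i *: x i /\
             ((0 < k)%N -> a k k.-1 != 0)]].

End Operators.

(* Main.v *)
Require Import Defs.
From HB Require Import structures.
From mathcomp Require Import all_boot all_order all_algebra.
From mathcomp Require Import complex.
From mathcomp Require Import all_classical all_reals all_analysis.
From mathcomp Require Import lra ring zify.

Set Implicit Arguments.
Unset Strict Implicit.
Unset Printing Implicit Defensive.

Import Order.TTheory GRing.Theory Num.Theory.
Import numFieldNormedType.Exports.

Local Open Scope classical_set_scope.
Local Open Scope ring_scope.
Local Open Scope complex_scope.

(**
  The vectors killed by some power of S are dense, so X has a linearly
  independent sequence (u k) with dense span such that S (u k) is in the span
  E k of the earlier vectors. Hahn-Banach gives bounded functionals f k that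
  vanish on E k with f k (u k) = 1, and S + sum_j eps_j f_(j+1)(.) u_j is a
  generalised backward 1-shift for suitable arbitrarily small eps_j.

  For a generalised backward 1-shift B and T = lambda + B there are vectors
  w k, with the same span as the u k, such that the linear map Phi sending 'X^k
  to w k satisfies T (Phi p) = lambda Phi (p ('X + 1)). Hence
  T^m (Phi p) = lambda^m Phi (p ('X + m)), and for p, q of degree < n the
  polynomials
    P_m = p (1 - 'X/m)^n + lambda^-m q('X - m) ('X/m)^n
  satisfy Phi P_m -> Phi p and T^m (Phi P_m) -> Phi q, so T is mixing.
*)

(** * The real-valued norm *)

Section RealNorm.
Context {R : realType}.
Implicit Types X : normedModType R[i].

(** The order on [R[i]] is only partial, so all estimates are carried out with the real number
    underlying the norm. *)
Definition rnorm X (x : X) : R := complex.Re `|x|.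

Lemma rnormE X (x : X) : `|x| = (rnorm x)%:C.
Proof. by rewrite /rnorm RRe_real // normr_real. Qed.

Lemma rnorm_ge0 X (x : X) : 0 <= rnorm x.
Proof. by rewrite -ler0c -rnormE. Qed.

Lemma rnorm0 X : rnorm (0 : X) = 0.
Proof. by rewrite /rnorm normr0. Qed.

Lemma rnorm0_eq0 X (x : X) : rnorm x = 0 -> x = 0.
Proof. by move=> x0; apply/eqP; rewrite -normr_eq0 rnormE x0. Qed.

Lemma rnorm_gt0 X (x : X) : x != 0 -> 0 < rnorm x.
Proof. by rewrite -normr_gt0 rnormE ltcR. Qed.

Lemma rnormN X (x : X) : rnorm (- x) = rnorm x.
Proof. by rewrite /rnorm normrN. Qed.

Lemma rnormB X (x y : X) : rnorm (x - y) = rnorm (y - x).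
Proof. by rewrite -rnormN opprB. Qed.

Lemma ler_rnormD X (x y : X) : rnorm (x + y) <= rnorm x + rnorm y.
Proof. by rewrite -lecR rmorphD /= -!rnormE ler_normD. Qed.

Lemma Re_norm_ge0 (c : R[i]) : 0 <= complex.Re `|c|.
Proof. by rewrite -ler0c RRe_real // normr_real. Qed.

Lemma Re_normM (c d : R[i]) : complex.Re `|c * d| = complex.Re `|c| * complex.Re `|d|.
Proof.
apply: complexI; rewrite (rmorphM (real_complex R)).
by rewrite !RRe_real ?normr_real // normrM.
Qed.

Lemma Re_ler_normD (c d : R[i]) :
  complex.Re `|c + d| <= complex.Re `|c| + complex.Re `|d|.
Proof. exact: (@ler_rnormD R[i]^o). Qed.

Lemma Re_normXn (c : R[i]) n : complex.Re `|c ^+ n| = complex.Re `|c| ^+ n.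
Proof.
elim: n => [|n IHn]; first by rewrite !expr0 normr1.
by rewrite !exprS Re_normM IHn.
Qed.

Lemma Re_normV (c : R[i]) : complex.Re `|c^-1| = (complex.Re `|c|)^-1.
Proof.
have [->|c0] := eqVneq c 0; first by rewrite invr0 normr0 /= invr0.
apply: (mulfI (x := complex.Re `|c|)).
  apply: contra_neq c0 => c0; apply/eqP.
  by rewrite -normr_eq0 -[`|c|]RRe_real ?normr_real // c0.
rewrite -Re_normM !divff ?normr1 //.
apply: contra_neq c0 => c0; apply/eqP.
by rewrite -normr_eq0 -[`|c|]RRe_real ?normr_real // c0.
Qed.

Lemma Re_norm_nat n : complex.Re `|n%:R : R[i]| = n%:R.
Proof. by rewrite -(rmorph_nat (real_complex R)) ger0_norm ?ler0c. Qed.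

Lemma rnormZ X (c : R[i]) (x : X) : rnorm (c *: x) = complex.Re `|c| * rnorm x.
Proof.
apply: complexI; rewrite -rnormE normrZ {1}rnormE -[in RHS]/(rnorm x).
rewrite -[X in X * _ = _](RRe_real (normr_real c)).
by rewrite -(rmorphM (real_complex R)).
Qed.

Lemma rnormZr X (t : R) (x : X) : 0 <= t -> rnorm (t%:C *: x) = t * rnorm x.
Proof. by move=> t0; rewrite rnormZ ger0_norm // ler0c. Qed.

Lemma bounded_operatorP X (T : {linear X -> X}) :
  bounded_operator T <-> exists2 M : R, 0 <= M & forall x, rnorm (T x) <= M * rnorm x.
Proof.
split=> [/linear_boundedP /pinfty_ex_gt0 [M M0 TM]|[M M0 TM]].
  have MR : M = (complex.Re M)%:C by rewrite RRe_real // gtr0_real.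
  exists (complex.Re M); first by rewrite -ler0c -MR ltW.
  by move=> x; rewrite -lecR rmorphM /= -!rnormE -MR.
apply/linear_boundedP; near=> r => x; apply: (@le_trans _ _ (M%:C * `|x|)).
  by rewrite !rnormE -rmorphM lecR.
apply: ler_wpM2r => //; near: r; apply: nbhs_pinfty_ge.
by rewrite ger0_real // ler0c.
Unshelve. all: by end_near. Qed.

Lemma open_rball X (U : set X) (x : X) : open U -> U x ->
  exists2 e : R, 0 < e & forall y, rnorm (y - x) < e -> U y.
Proof.
move=> Uo Ux; have /nbhs_normP [e /= e0 eU] : nbhs x U by apply: open_nbhs_nbhs.
have eR : e = (complex.Re e)%:C by rewrite RRe_real // gtr0_real.
exists (complex.Re e); first by rewrite -ltcR -eR.
by move=> y yx; apply: eU => /=; rewrite rnormE rnormB eR ltcR.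
Qed.

Lemma denseP X (A : set X) :
  dense A <-> forall (x : X) (e : R), 0 < e -> exists2 y, A y & rnorm (y - x) < e.
Proof.
split=> [Ad x e e0|Ad U [x Ux] Uo]; last first.
  have [e e0 eU] := open_rball Uo Ux; have [y Ay yx] := Ad x e e0.
  by exists y; split => //; apply: eU.
have e0' : 0 < e%:C :> R[i] by rewrite ltcR.
have [||y [xy Ay]] := Ad (ball x e%:C).
- by exists x; exact: ballxx.
- exact: ball_open.
exists y => //; move: xy; rewrite -ball_normE /= => xy.
by rewrite -ltcR -rnormE distrC.
Qed.

Lemma rcvgP X (s : nat -> X) (l : X) : s @ \oo --> l <->
  forall e : R, 0 < e -> exists N, forall n, (N <= n)%N -> rnorm (s n - l) < e.
Proof.
split=> [/cvgrPdist_lt sl e e0|sl].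
  have [|N _ sN] := sl e%:C; first by rewrite ltcR.
  by exists N => n /sN /=; rewrite rnormB rnormE ltcR.
apply/cvgrPdist_lt => e e0.
have eR : e = (complex.Re e)%:C by rewrite RRe_real // gtr0_real.
have [|N sN] := sl (complex.Re e); first by rewrite -ltcR -eR.
by exists N => // n /= Nn; rewrite rnormE rnormB eR ltcR sN.
Qed.

Lemma rcauchy_cvg (X : completeNormedModType R[i]) (s : nat -> X) :
  (forall e : R, 0 < e -> exists N, forall m n, (N <= m)%N -> (N <= n)%N ->
    rnorm (s m - s n) < e) ->
  cvg (s @ \oo).
Proof.
move=> sC; apply/cauchy_cvgP/cauchy_ballP => e e0.
have eR : e = (complex.Re e)%:C by rewrite RRe_real // gtr0_real.
have [|N sN] := sC (complex.Re e); first by rewrite -ltcR -eR.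
exists (s @` [set n | N <= n]%N, s @` [set n | N <= n]%N) => /=.
  by split; exists N => // n Nn; exists n.
move=> [_ _] [/= [m Nm <-] [n Nn <-]].
by rewrite -ball_normE /= rnormE eR ltcR sN.
Qed.

End RealNorm.

(** * Hahn-Banach *)

Section HahnBanach.
Context {R : realType}.

(** * Sublinear functionals and minimal elements below them *)

Section Sublinear.
Context {V : lmodType R[i]}.
Implicit Types (p q f : V -> R) (v x y : V) (t : R).

(** Homogeneity is an inequality for [t > 0] only, a form that passes easily to infima; applying it
    to [t^-1] gives the reverse inequality. *)
Definition sublinear p : Prop :=
  (forall x y, p (x + y) <= p x + p y) /\
  (forall t x, 0 < t -> p (t%:C *: x) <= t * p x).

Lemma sublinear0_ge0 p : sublinear p -> 0 <= p 0.
Proof. by case=> /(_ 0 0); rewrite addr0 -lerBlDl subrr. Qed.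

Lemma sublinear_geN p x : sublinear p -> - p (- x) <= p x.
Proof.
move=> ps; have := ps.1 x (- x); rewrite subrr; have := sublinear0_ge0 ps.
lra.
Qed.

Lemma sublinear_homo_ge p t x : sublinear p -> 0 <= t -> t * p x <= p (t%:C *: x).
Proof.
move=> ps; rewrite le_eqVlt => /predU1P[<-|t0].
  by rewrite mul0r scale0r sublinear0_ge0.
have := ps.2 t^-1 (t%:C *: x); rewrite invr_gt0 => /(_ t0).
rewrite scalerA -rmorphM /= mulVf ?gt_eqF // scale1r => le_px.
by rewrite -ler_pdivlMl.
Qed.

(** A sublinear functional below [p], lowered in the direction [- v]: the parameter [t = 1] shows
    that its value at [- v] is at most [p 0 - p v]. *)
Definition shear p v x : R :=
  inf [set p (x + t%:C *: v) - t * p v | t in [set t | 0 <= t]].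

Lemma shear_le p v t x : sublinear p -> 0 <= t ->
  shear p v x <= p (x + t%:C *: v) - t * p v.
Proof.
move=> ps t0; apply: ge_inf; last by exists t.
(* The infimum is over a set bounded below, since [s * p v <= p (s v) <= p (- x) + p (x + s v)]. *)
exists (- p (- x)) => _ [s s0 <-]; have := sublinear_homo_ge v ps s0.
by have := ps.1 (- x) (x + s%:C *: v); rewrite addKr; lra.
Qed.

Lemma shear_ge p v x b :
  (forall t, 0 <= t -> b <= p (x + t%:C *: v) - t * p v) -> b <= shear p v x.
Proof.
move=> lb; apply: lb_le_inf => [|_ [t t0 <-]]; last exact: lb.
by exists (p (x + 0%:C *: v) - 0 * p v), 0 => /=.
Qed.

(** Parameters [s] for [x] and [t] for [y] combine into [s + t] for [x + y]; a parameter [s] for [x]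
    becomes [t * s] for [t x]. *)
Lemma sublinear_shear p v : sublinear p -> sublinear (shear p v).
Proof.
move=> ps; split=> [x y|t x t0].
  rewrite -lerBlDr; apply: shear_ge => s s0; rewrite lerBlDr -lerBlDl.
  apply: shear_ge => t t0; rewrite lerBlDl.
  apply: (le_trans (shear_le v (x + y) ps (addr_ge0 s0 t0))).
  rewrite rmorphD /= scalerDl addrACA mulrDl.
  by have := ps.1 (x + s%:C *: v) (y + t%:C *: v); lra.
rewrite -ler_pdivrMl //; apply: shear_ge => s s0; rewrite ler_pdivrMl //.
apply: (le_trans (shear_le v (t%:C *: x) ps (mulr_ge0 (ltW t0) s0))).
rewrite rmorphM /= -scalerA -scalerDr mulrBr mulrA lerD2r.
exact: ps.2.
Qed.

Lemma shear_le_id p v x : sublinear p -> shear p v x <= p x.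
Proof.
by move=> ps; have := shear_le v x ps (lexx 0); rewrite scale0r addr0 mul0r subr0.
Qed.

(** Zorn's lemma, with the pointwise infimum as bound of a chain. It is finite because every [q]
    below [p] satisfies [q x >= - q (- x) >= - p (- x)]. *)
Lemma exists_minimal_sublinear p : sublinear p ->
  exists f, [/\ sublinear f, forall x, f x <= p x &
    forall q, sublinear q -> (forall x, q x <= f x) -> forall x, f x <= q x].
Proof.
move=> ps; pose P q := sublinear q /\ forall x, q x <= p x.
have Pp : P p by split.
(* The pointwise order is reversed, so that a maximal element for [below] is a minimal
   functional. *)
pose below (q r : {q | P q}) := `[< forall x, sval r x <= sval q x >].
have [||A Atot|[f [fs fp]] fmin] := @ZL_preorder _ (exist _ _ Pp) below.
- by move=> q; apply/asboolP.
- move=> q r s /asboolP qr /asboolP rs; apply/asboolP => x.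
  exact: le_trans (rs x) (qr x).
- have [[q0 Aq0]|A0] := pselect (A !=set0); last first.
    by exists (exist _ _ Pp) => s As; case: A0; exists s.
  pose m x := inf [set sval q x | q in A].
  have m_le (q : {q | P q}) x : A q -> m x <= sval q x.
    move=> Aq; apply: ge_inf; last by exists q.
    exists (- p (- x)) => _ [r _ <-]; have [rs rp] := svalP r.
    by have := sublinear_geN x rs; have := rp (- x); lra.
  have m_ge b x : (forall q : {q | P q}, A q -> b <= sval q x) -> b <= m x.
    move=> lb; apply: lb_le_inf => [|_ [q Aq <-]]; last exact: lb.
    by exists (sval q0 x), q0.
  have Pm : P m.
    split; last by move=> x; apply: (le_trans (m_le q0 x Aq0)); case: (svalP q0).
    split=> [x y|t x t0].
      rewrite -lerBlDr; apply: (m_ge) => q Aq; rewrite lerBlDr -lerBlDl.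
      apply: (m_ge) => r Ar; rewrite lerBlDl.
      (* Of two members of the chain, the smaller one bounds the infimum at [x + y] and lies below
         the other at both points. *)
      have [/asboolP rq|/asboolP qr] := Atot _ _ Aq Ar.
        apply: (le_trans (m_le r _ Ar)); apply: (le_trans ((svalP r).1.1 _ _)).
        by rewrite lerD2r.
      apply: (le_trans (m_le q _ Aq)); apply: (le_trans ((svalP q).1.1 _ _)).
      by rewrite lerD2l.
    rewrite -ler_pdivrMl //; apply: (m_ge) => q Aq; rewrite ler_pdivrMl //.
    by apply: (le_trans (m_le q _ Aq)); apply: (svalP q).1.2.
  by exists (exist _ _ Pm) => q Aq; apply/asboolP => x; exact: m_le.
- exists f; split=> // q qs qf.
  have Pq : P q by split=> // x; exact: le_trans (qf x) (fp x).
  by have /(_ _)/asboolP := fmin (exist _ _ Pq); apply; apply/asboolP.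
Qed.

(* A minimal sublinear functional is unchanged by every shear, which gives
   [f x <= f (x + y) - f y]; no extension from a subspace is needed. *)
Lemma exists_real_linear_le p : sublinear p ->
  exists f, [/\ {morph f : x y / x + y}, forall t x, f (t%:C *: x) = t * f x &
    forall x, f x <= p x].
Proof.
move=> /exists_minimal_sublinear [f [fs fp fmin]]; exists f.
have fD : {morph f : x y / x + y}.
  move=> x y; apply/eqP; rewrite eq_le fs.1 /=.
  have f_le := fmin _ (sublinear_shear y fs) (fun x => shear_le_id y x fs) x.
  have := le_trans f_le (shear_le y x fs ler01).
  by rewrite scale1r mul1r lerBrDr.
have f0 : f 0 = 0 by have := fD 0 0; rewrite addr0; lra.
have fN x : f (- x) = - f x by have := fD x (- x); rewrite subrr f0; lra.
have ft t x : 0 <= t -> f (t%:C *: x) = t * f x.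
  rewrite le_eqVlt => /predU1P[<-|t0]; first by rewrite scale0r mul0r.
  apply/eqP; rewrite eq_le fs.2 //=.
  exact: sublinear_homo_ge fs (ltW t0).
split=> // t x; have [/ft //|t0] := leP 0 t.
rewrite -[t]opprK rmorphN scaleNr fN ft ?mulNr //; lra.
Qed.

End Sublinear.

Lemma sublinear_rnorm (V : normedModType R[i]) : sublinear (@rnorm R V).
Proof.
split=> [|t x t0]; first exact: ler_rnormD.
by rewrite rnormZr // ltW.
Qed.

(** The real functional is taken below the shear of the norm along [v], not merely below the norm.
    This forces [g (- v) <= - rnorm v], hence [g v != 0]; complexifying and dividing by the value at
    [v] finishes. *)
Lemma separating_functional (V : normedModType R[i]) (v : V) : v != 0 ->
  exists f : {scalar V},
    (exists M : R, forall x, complex.Re `|f x| <= M * rnorm x) /\ f v = 1.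
Proof.
move=> v0; have ns := sublinear_rnorm V.
have [g [gD gZ g_le]] := exists_real_linear_le (sublinear_shear v ns).
have g_norm x : `|g x| <= rnorm x.
  have gle y : g y <= rnorm y by exact: le_trans (g_le y) (shear_le_id v y ns).
  have gN : g (- x) = - g x by rewrite -scaleN1r -(rmorphN1 (real_complex R)) gZ mulN1r.
  by rewrite ler_norml gle lerNl -gN -(rnormN x) gle.
have gv : g v != 0.
  have := le_trans (g_le (- v)) (shear_le v (- v) ns ler01).
  rewrite scale1r addNr rnorm0 mul1r => gNv.
  have := gD v (- v); rewrite subrr.
  have := gZ 0 0; rewrite scaler0 mul0r => ->; have := rnorm_gt0 v0.
  by move=> v_gt0 gvN; apply/eqP => gv0; lra.
(* The usual complexification [g x - i g (i x)] of a real-linear functional. *)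
pose h x : R[i] := (g x) -i* g ('i%C *: x).
have hlin : scalar h.
  move=> [a b] x y; rewrite /h.
  have cE : (a +i* b)%C = a%:C + 'i%C * b%:C by simpc.
  have E1 : g ((a +i* b)%C *: x + y) = a * g x + b * g ('i%C *: x) + g y.
    by rewrite cE gD scalerDl gD gZ (mulrC 'i%C) -scalerA gZ.
  have E2 : g ('i%C *: ((a +i* b)%C *: x + y)) =
      a * g ('i%C *: x) - b * g x + g ('i%C *: y).
    rewrite scalerDr gD scalerA.
    have -> : 'i%C * (a +i* b)%C = (- b)%:C + a%:C * 'i%C :> R[i] by simpc.
    by rewrite scalerDl gD gZ -scalerA gZ; lra.
  rewrite E1 E2; simpc; congr (_ +i* _)%C; lra.
have hv : h v != 0 by rewrite /h eq_complex /= negb_and gv.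
have flin : scalar (fun x => (h v)^-1 * h x).
  by move=> c x y; rewrite hlin mulrDr mulrCA.
pose f : {scalar V} := HB.pack (fun x => (h v)^-1 * h x)
  (GRing.isLinear.Build _ _ _ _ (fun x => (h v)^-1 * h x) flin).
exists f; split; last by rewrite /f /= mulVf.
(* The factor 2 comes from bounding the real and imaginary parts of [h x] separately by
   [rnorm x]. *)
exists (complex.Re `|(h v)^-1| * 2) => x.
change (f x) with ((h v)^-1 * h x).
rewrite Re_normM -mulrA; apply: ler_wpM2l; first exact: Re_norm_ge0.
have -> : h x = (g x)%:C + 'i%C * (- g ('i%C *: x))%:C by rewrite /h; simpc.
have rC (a : R) : complex.Re `|a%:C| = `|a|.
  by rewrite normc_def /= expr0n /= addr0 sqrtr_sqr.
have ri : complex.Re `|'i%C : R[i]| = 1.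
  by rewrite normc_def /= expr0n /= add0r expr1n sqrtr1.
apply: (le_trans (Re_ler_normD _ _)); rewrite Re_normM ri mul1r !rC normrN.
have := g_norm ('i%C *: x); rewrite rnormZ ri mul1r; have := g_norm x; lra.
Qed.

End HahnBanach.

(** * Spans of initial segments *)

Section PrefixSpan.
Context {K : fieldType} {V : lmodType K}.
Implicit Types (u v : nat -> V) (x y : V) (c : K).

(** The span [E n] of [u 0, ..., u (n - 1)]. Coefficients are indexed by [nat], so that changing [n]
    requires no cast between ordinals. *)
Definition prefix_span u n : set V :=
  [set x | exists c : nat -> K, x = \sum_(i < n) c i *: u i].

Lemma prefix_spanZD u n c x y :
  prefix_span u n x -> prefix_span u n y -> prefix_span u n (c *: x + y).
Proof.
move=> [a ->] [b ->]; exists (fun i => c * a i + b i).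
rewrite scaler_sumr -big_split /=; apply: eq_bigr => i _.
by rewrite scalerDl scalerA.
Qed.

Lemma prefix_span0 u n : prefix_span u n 0.
Proof. by exists (fun=> 0); rewrite big1 // => i _; rewrite scale0r. Qed.

Lemma prefix_spanZ u n c x : prefix_span u n x -> prefix_span u n (c *: x).
Proof.
by move=> xu; rewrite -[_ *: _]addr0; apply: prefix_spanZD => //; exact: prefix_span0.
Qed.

Lemma prefix_spanD u n x y :
  prefix_span u n x -> prefix_span u n y -> prefix_span u n (x + y).
Proof. by move=> xu; rewrite -[x]scale1r; exact: prefix_spanZD. Qed.

Lemma prefix_spanB u n x y :
  prefix_span u n x -> prefix_span u n y -> prefix_span u n (x - y).
Proof. by move=> xu yu; rewrite addrC -scaleN1r; exact: prefix_spanZD. Qed.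

Lemma prefix_span_sum u n (I : Type) (r : seq I) (P : pred I) (F : I -> V) :
  (forall i, P i -> prefix_span u n (F i)) ->
  prefix_span u n (\sum_(i <- r | P i) F i).
Proof.
by move=> Fu; elim/big_ind: _ => //; [exact: prefix_span0|exact: prefix_spanD].
Qed.

Lemma mem_prefix_span u n i : (i < n)%N -> prefix_span u n (u i).
Proof.
move=> i_n; exists (fun j => (j == i)%:R); rewrite (bigD1 (Ordinal i_n)) //=.
rewrite eqxx scale1r big1 ?addr0 // => j ji.
by rewrite (_ : (j == i :> nat) = false) ?scale0r //; apply: negbTE.
Qed.

Lemma sub_prefix_span u v n m :
  (forall i, (i < n)%N -> prefix_span v m (u i)) ->
  prefix_span u n `<=` prefix_span v m.
Proof.
by move=> uv _ [c ->]; apply: prefix_span_sum => i _; exact/prefix_spanZ/uv.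
Qed.

Lemma prefix_span_le u n m : (n <= m)%N -> prefix_span u n `<=` prefix_span u m.
Proof.
move=> n_m; apply: sub_prefix_span => i i_n.
by apply: mem_prefix_span; exact: leq_trans n_m.
Qed.

Lemma eq_prefix_span u v n : (forall i, (i < n)%N -> u i = v i) ->
  prefix_span u n `<=` prefix_span v n.
Proof.
by move=> uv; apply: sub_prefix_span => i i_n; rewrite uv //; exact: mem_prefix_span.
Qed.

Lemma prefix_spanS u n x :
  prefix_span u n.+1 x <-> exists c, prefix_span u n (x - c *: u n).
Proof.
split=> [[a ->]|[c xu]].
  by exists (a n), a; rewrite big_ord_recr /= addrK.
rewrite -(subrK (c *: u n) x); apply: prefix_spanD.
  exact: prefix_span_le xu.
by apply: prefix_spanZ; exact: mem_prefix_span.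
Qed.

Lemma image_prefix_span u v n m (T : {linear V -> V}) :
  (forall i, (i < n)%N -> prefix_span v m (T (u i))) ->
  forall x, prefix_span u n x -> prefix_span v m (T x).
Proof.
move=> Tu _ [c ->]; rewrite linear_sum; apply: prefix_span_sum => i _.
by rewrite linearZ; exact/prefix_spanZ/Tu.
Qed.

Lemma prefix_span_linear_span u n : prefix_span u n `<=` linear_span (range u).
Proof.
move=> _ [c ->]; exists n, (fun i => c i), (fun i => u i).
by split=> // i; exists (i : nat).
Qed.

Lemma linear_span_prefix_span u x :
  linear_span (range u) x -> exists n, prefix_span u n x.
Proof.
move=> [m [c [v [vu ->]]]]; have /choice [k vk] : forall i, exists k, u k = v i.
  by move=> i; have [k _ <-] := vu i; exists k.
exists (\max_(i < m) (k i).+1)%N; apply: prefix_span_sum => i _.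
apply: prefix_spanZ; rewrite -vk; apply: mem_prefix_span.
exact: (leq_bigmax i).
Qed.

(** In a vanishing combination the last coefficient must be zero, since dividing by it would put the
    last vector in the span of the earlier ones; then induct. *)
Lemma linearly_independent_prefix u :
  (forall n, ~ prefix_span u n (u n)) -> linearly_independent u.
Proof.
move=> u_ind; elim=> [|n IHn] c; first by move=> _ [].
rewrite big_ord_recr /= => cu.
have cn : c ord_max = 0.
  apply/eqP/negP => /negP cn; apply: (u_ind n).
  have -> : u n = - (c ord_max)^-1 *: \sum_(i < n) c (widen_ord (leqnSn n) i) *: u i.
    rewrite [X in _ *: X](_ : _ = - (c ord_max *: u n)).
      by rewrite scaleNr scalerN opprK scalerA mulVf // scale1r.
    by apply/eqP; rewrite -addr_eq0 cu.
  apply: prefix_spanZ; apply: prefix_span_sum => i _; apply: prefix_spanZ.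
  exact: mem_prefix_span.
move: cu; rewrite cn scale0r addr0 => /IHn c0 i.
have [i_n|] := ltnP i n.
  by rewrite -(c0 (Ordinal i_n)); congr c; exact: val_inj.
rewrite leq_eqVlt ltnNge -ltnS ltn_ord orbF => /eqP ni.
by rewrite -cn; congr c; exact: val_inj.
Qed.

End PrefixSpan.

(** * Bounded projections onto initial spans and dual functionals *)

Section Projection.
Context {R : realType} {X : normedModType R[i]}.
Implicit Types (u : nat -> X) (x y : X).

(** Take a functional equal to 1 at the nonzero vector [u n - P (u n)] and precompose it with
    [I - P], which kills [E n]. *)
Lemma dual_functional_of_projection u n (P : {linear X -> X}) :
  bounded_operator P -> (forall x, prefix_span u n (P x)) ->
  (forall x, prefix_span u n x -> P x = x) -> ~ prefix_span u n (u n) ->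
  exists f : {scalar X}, [/\ exists M : R, forall x, complex.Re `|f x| <= M * rnorm x,
    forall x, prefix_span u n x -> f x = 0 & f (u n) = 1].
Proof.
move=> /bounded_operatorP [M M0 PM] Pu Pid u_ind.
have [|f [[C fC] f1]] := @separating_functional R X (u n - P (u n)).
  by apply/eqP => /eqP; rewrite subr_eq0 => /eqP un; apply: u_ind; rewrite un.
have glin : scalar (fun x => f (x - P x)).
  by move=> c x y; rewrite (linearP P) opprD addrACA -scalerBr linearP.
pose g : {scalar X} := HB.pack (fun x => f (x - P x))
  (GRing.isLinear.Build _ _ _ _ (fun x => f (x - P x)) glin).
exists g; split=> [|x /Pid Px|//]; last by rewrite /g /= Px subrr linear0.
(* The sign of [C] is unknown, hence the absolute value. *)
exists (`|C| * (1 + M)) => x; apply: (le_trans (fC _)).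
apply: (le_trans (ler_wpM2r (rnorm_ge0 _) (ler_norm C))).
rewrite -mulrA; apply: ler_wpM2l => //.
apply: (le_trans (ler_rnormD _ _)); rewrite rnormN.
by have := PM x; lra.
Qed.

(** Induction by rank-one updates: with [f] dual to a new vector [u n], the term
    [f x *: (u n - P (u n))] vanishes on [E n] and corrects [P (u n)] to [u n]. *)
Lemma prefix_span_projection u n : exists P : {linear X -> X},
  [/\ bounded_operator P, forall x, prefix_span u n (P x) &
    forall x, prefix_span u n x -> P x = x].
Proof.
elim: n => [|n [P [Pb Pu Pid]]].
  exists (\0)%R; split=> [|x|x [c ->]]; last by rewrite big_ord0.
    by apply/bounded_operatorP; exists 0 => // x; rewrite /= rnorm0 mul0r.
  exact: prefix_span0.
(* Independence is not assumed: a vector already in the span leaves the projection unchanged. *)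
have [un|un] := pselect (prefix_span u n (u n)).
  exists P; split=> // [x|x /prefix_spanS [c xu]].
    exact: prefix_span_le (Pu x).
  apply: Pid; rewrite -(subrK (c *: u n) x).
  by apply: prefix_spanD => //; exact: prefix_spanZ.
have [f [[C fC] f0 f1]] := dual_functional_of_projection Pb Pu Pid un.
pose v := u n - P (u n).
have Qlin : linear (fun x => P x + f x *: v).
  by move=> c x y; rewrite !linearP /= scalerDl addrACA -scalerA -scalerDr.
pose Q : {linear X -> X} := HB.pack (fun x => P x + f x *: v)
  (GRing.isLinear.Build _ _ _ _ (fun x => P x + f x *: v) Qlin).
have vu : prefix_span u n.+1 v.
  by apply: prefix_spanB; [exact: mem_prefix_span|exact: prefix_span_le (Pu _)].
exists Q; split=> [|x|x /prefix_spanS [c xu]].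
- move: Pb => /bounded_operatorP [M M0 PM]; apply/bounded_operatorP.
  exists (M + `|C| * rnorm v) => [|x]; first by rewrite addr_ge0 ?mulr_ge0 ?rnorm_ge0.
  apply: (le_trans (ler_rnormD _ _)); rewrite rnormZ mulrDl lerD // mulrAC.
  apply: ler_wpM2r; first exact: rnorm_ge0.
  by apply: (le_trans (fC x)); apply: ler_wpM2r; [exact: rnorm_ge0|exact: ler_norm].
- by apply: prefix_spanD; [exact: prefix_span_le (Pu _)|exact: prefix_spanZ].
- have Px : P x = x - c *: u n + c *: P (u n).
    rewrite -[in LHS](subrK (c *: u n) x) linearD (Pid _ xu).
    by congr (_ + _); exact: linearZ_LR.
  have fx : f x = c.
    rewrite -[in LHS](subrK (c *: u n) x) linearD f0 // add0r.
    by rewrite (linearZ_LR f) /= f1 mulr1.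
  by rewrite /Q /= Px fx /v scalerBr -addrA [c *: P _ + _]addrCA subrr addr0 subrK.
Qed.

Lemma dual_functional u n : ~ prefix_span u n (u n) ->
  exists f : {scalar X}, [/\ exists M : R, forall x, complex.Re `|f x| <= M * rnorm x,
    forall x, prefix_span u n x -> f x = 0 & f (u n) = 1].
Proof.
have [P [Pb Pu Pid]] := prefix_span_projection u n.
exact: dual_functional_of_projection Pb Pu Pid.
Qed.

(** If [A] were contained in [E n], the bounded projection onto [E n] would fix a dense set, hence
    be the identity, and [X] would be spanned by [n] vectors. *)
Lemma not_prefix_span_dense u n (A : set X) :
  infinite_dimensional X -> dense A -> exists2 y, A y & ~ prefix_span u n y.
Proof.
move=> Xinf Ad; have [//|noA] := pselect (exists2 y, A y & ~ prefix_span u n y).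
have Au y : A y -> prefix_span u n y.
  by move=> Ay; apply: contrapT => yu; apply: noA; exists y.
have [P [/bounded_operatorP [M M0 PM] Pu Pid]] := prefix_span_projection u n.
have PX x : P x = x.
  apply/eqP; rewrite -subr_eq0; apply/eqP/rnorm0_eq0/eqP; rewrite eq_le rnorm_ge0 andbT.
  apply/ler_addgt0Pl => e e0; rewrite addr0.
  (* The choice of radius matches [rnorm (P x - x) <= (M + 1) * rnorm (x - y)]. *)
  have [|y Ay yx] := (denseP A).1 Ad x (e / (M + 1)).
    by rewrite divr_gt0 // ltr_wpDl.
  have -> : P x - x = P (x - y) - (x - y).
    by rewrite linearB /= (Pid y (Au y Ay)) opprB addrA subrK.
  apply: (le_trans (ler_rnormD _ _)); rewrite rnormN.
  have := PM (x - y); rewrite [rnorm (x - y)]rnormB => PMxy.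
  apply: (le_trans (lerD PMxy (lexx _))).
  by rewrite -[X in _ + X]mul1r -mulrDl mulrC -ler_pdivlMr ?ltr_wpDl // ltW.
case: Xinf; exists (u @` `I_n); split; first exact/finite_image/finite_II.
apply/seteqP; split=> // x _; rewrite -(PX x); have [c ->] := Pu x.
exists n, (fun i => c i), (fun i => u i); split=> // i.
by exists (i : nat) => //=; exact: ltn_ord.
Qed.

End Projection.

(** * A triangular basis *)

Section TriangularBasis.
Context {R : realType} {X : normedModType R[i]}.
Implicit Types (u : nat -> X) (x y : X) (l : seq X).

(** A countable dense set may miss [A], so each of its points is approximated from within [A] to
    every precision [1 / (m + 1)]. *)
Lemma separable_dense_sequence (A : set X) :
  separable_space X -> dense A ->
  exists y : nat -> X, (forall i, A (y i)) /\ dense (range y).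
Proof.
move=> [D [Dc Dd]] Ad.
have [d dD] : exists d : nat -> X, D `<=` range d.
  have [->|/set0P D0] := eqVneq D set0; first by exists (fun=> 0) => ?.
  by have /pcard_surjP [d dD] := Dc; exists d.
have Ae p : exists y, A y /\ rnorm (y - d p.1) < p.2.+1%:R^-1.
  by have [|y Ay yd] := (denseP A).1 Ad (d p.1) p.2.+1%:R^-1; [rewrite invr_gt0|exists y].
have [y0 Ay0] : exists y, A y by have [y []] := Ae (0%N, 0%N); exists y.
have /choice [f fP] := Ae.
(* Pairs (point, precision) are enumerated by their codes; [y0] is the default at integers that code
   no pair. *)
exists (fun i => if unpickle i is Some p then f p else y0); split=> [i|].
  by case: unpickle => // p; case: (fP p).
apply/denseP => x e e0; have e2 : 0 < e / 2 by rewrite divr_gt0.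
have [z Dz zx] := (denseP D).1 Dd x (e / 2) e2.
have [n _ dn] := dD z Dz; rewrite -{}dn in zx.
pose m := Num.trunc (e / 2)^-1; exists (f (n, m)).
  by exists (pickle (n, m)) => //; rewrite pickleK.
have [_ /= fd] := fP (n, m).
have me : m.+1%:R^-1 < e / 2.
  rewrite -[ltRHS]invrK ltf_pV2 ?posrE ?invr_gt0 ?divr_gt0 //.
  exact: truncnS_gt.
have := ler_rnormD (f (n, m) - d n) (d n - x).
rewrite addrA subrK; have {fd me} := lt_trans fd me; lra.
Qed.

Context (S : {linear X -> X}).

(** Finite stages of the basis to be built: on such a list [S] is strictly upper triangular. *)
Definition triangular_seq l := forall k, (k < size l)%N ->
  ~ prefix_span (nth 0 l) k (nth 0 l k) /\ prefix_span (nth 0 l) k (S (nth 0 l k)).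

Lemma prefix_span_cat l l' k : (k <= size l)%N ->
  prefix_span (nth 0 (l ++ l')) k = prefix_span (nth 0 l) k.
Proof.
move=> kl; apply/seteqP; split; apply: eq_prefix_span => i ik;
  by rewrite nth_cat (leq_trans ik kl).
Qed.

Lemma triangular_seq_rcons l y : triangular_seq l ->
  ~ prefix_span (nth 0 l) (size l) y -> prefix_span (nth 0 l) (size l) (S y) ->
  triangular_seq (l ++ [:: y]).
Proof.
move=> lt yl Syl k; rewrite size_cat addn1 ltnS leq_eqVlt => /predU1P[->|kl].
  by rewrite prefix_span_cat // nth_cat ltnn subnn.
by rewrite prefix_span_cat ?(ltnW kl) // nth_cat kl; exact: lt.
Qed.

(* Adjoining the last powers [S^j y] first keeps the list triangular. *)
Lemma triangular_seq_extend n l y : triangular_seq l -> iter n S y = 0 ->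
  exists l', triangular_seq (l ++ l') /\
    prefix_span (nth 0 (l ++ l')) (size (l ++ l')) y.
Proof.
move=> lt; elim: n y => [y /= ->|n IHn y].
  by exists [::]; rewrite cats0; split=> //; exact: prefix_span0.
rewrite iterSr => /IHn [l1 [l1t Syl1]].
have [yl1|yl1] := pselect (prefix_span (nth 0 (l ++ l1)) (size (l ++ l1)) y).
  by exists l1.
exists (l1 ++ [:: y]); rewrite catA; split; first exact: triangular_seq_rcons.
set l2 := (l ++ l1) ++ [:: y].
have := @mem_prefix_span _ _ (nth 0 l2) (size l2) (size (l ++ l1)).
by rewrite /l2 nth_cat ltnn subnn /=; apply; rewrite [X in (_ < X)%N]size_cat addn1.
Qed.

(** Lists are extended in stages. Stage [n] absorbs a kernel vector outside the current span, so
    that the list grows, and then [y n], so that the final span contains a dense sequence. *)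
Lemma exists_triangular_basis :
  separable_space X -> infinite_dimensional X -> dense (generalised_kernel S) ->
  exists u, [/\ forall k, ~ prefix_span u k (u k),
    forall k, prefix_span u k (S (u k)) & dense (linear_span (range u))].
Proof.
move=> Xsep Xinf Sd; have [y [yS yd]] := separable_dense_sequence Xsep Sd.
have step (p : nat * seq X) : exists l', triangular_seq p.2 ->
    [/\ triangular_seq (p.2 ++ l'), (0 < size l')%N &
      prefix_span (nth 0 (p.2 ++ l')) (size (p.2 ++ l')) (y p.1)].
  have [lt|] := pselect (triangular_seq p.2); last by exists [::].
  have [z [m _ mz] zl] := not_prefix_span_dense (nth 0 p.2) (size p.2) Xinf Sd.
  have [l1 [l1t zl1]] := triangular_seq_extend lt mz.
  have [n _ ny] := yS p.1.
  have [l2 [l2t yl2]] := triangular_seq_extend l1t ny.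
  exists (l1 ++ l2) => _; rewrite catA; split=> //.
  (* An empty [l1] would put [z] in the old span, against its choice. *)
  rewrite size_cat; case: l1 zl1 {l1t l2t yl2} => [|a l1 _ //].
  by rewrite cats0.
have /choice [F FP] := step.
pose L := fix L n := if n is n'.+1 then L n' ++ F (n', L n') else [::].
have Lt n : triangular_seq (L n).
  by elim: n => [|n IHn] //=; have [] := FP (n, L n) IHn.
have sizeL n : (n <= size (L n))%N.
  elim: n => // n IHn /=; have [_ + _] := FP (n, L n) (Lt n).
  by rewrite size_cat; move: IHn; lia.
have LE n m : exists l', L (n + m)%N = L n ++ l'.
  elim: m => [|m [l' IHm]]; first by exists [::]; rewrite addn0 cats0.
  by rewrite addnS /= IHm; exists (l' ++ F ((n + m)%N, L n ++ l')); rewrite catA.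
(* [L k.+1] has at least [k + 1] entries, and later lists only append to it, so the default 0 is
   never read. *)
pose u k := nth 0 (L k.+1) k.
have Lu n k : (k < size (L n))%N -> nth 0 (L n) k = u k.
  move=> kn; rewrite /u; have [nk|/ltnW kn'] := leqP n k.+1.
    by have [l'] := LE n (k.+1 - n)%N; rewrite subnKC // => ->; rewrite nth_cat kn.
  have [l'] := LE k.+1 (n - k.+1)%N; rewrite subnKC // => ->.
  by rewrite nth_cat (sizeL k.+1).
have Lspan n k : (k <= size (L n))%N -> prefix_span (nth 0 (L n)) k = prefix_span u k.
  move=> kn; apply/seteqP; split; apply: eq_prefix_span => i ik;
    by rewrite Lu // (leq_trans ik kn).
exists u; split=> [k|k|].
- by have [+ _] := Lt k.+1 k (sizeL k.+1); rewrite Lspan ?Lu // ltnW.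
- by have [_ +] := Lt k.+1 k (sizeL k.+1); rewrite Lspan ?Lu // ltnW.
- apply/denseP => x e e0; have [_ [n _ <-] yx] := (denseP (range y)).1 yd x e e0.
  exists (y n) => //; have [_ _] := FP (n, L n) (Lt n).
  by rewrite -/(L n.+1) Lspan // => /prefix_span_linear_span.
Qed.

End TriangularBasis.

(** * Perturbation to a shift *)

Section Perturbation.
Context {R : realType} {X : completeNormedModType R[i]}.
Implicit Types (u : nat -> X) (x y : X).

(** The series converges pointwise by completeness; its bound is [C] because the weights
    [2^-(j + 1)] sum to 1. *)
Lemma exists_sum_operator (h : nat -> {linear X -> X}) (C : R) : 0 <= C ->
  (forall j x, rnorm (h j x) <= C * 2^-1 ^+ j.+1 * rnorm x) ->
  exists K : {linear X -> X}, (forall x, rnorm (K x) <= C * rnorm x) /\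
    forall x k, (forall j, (k <= j)%N -> h j x = 0) -> K x = \sum_(j < k) h j x.
Proof.
move=> C0 hC; pose s x n := \sum_(j < n) h j x.
(* Telescoping: each weight equals [2^-j - 2^-(j + 1)]. *)
have s_tail x n m : rnorm (s x (n + m)%N - s x n) <=
    C * rnorm x * (2^-1 ^+ n - 2^-1 ^+ (n + m)).
  elim: m => [|m IHm]; first by rewrite addn0 !subrr rnorm0 mulr0.
  rewrite addnS /s big_ord_recr /= -/(s x n) -/(s x _) addrAC.
  apply: (le_trans (ler_rnormD _ _)).
  apply: (le_trans (lerD IHm (hC _ _))).
  by rewrite [X in _ + X]mulrAC -mulrDr ler_wpM2l ?mulr_ge0 ?rnorm_ge0 // exprS; lra.
have s_tail_le x n m : (n <= m)%N ->
    rnorm (s x m - s x n) <= C * rnorm x * 2^-1 ^+ n.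
  move=> nm; have := s_tail x n (m - n)%N; rewrite subnKC // => /le_trans; apply.
  by rewrite ler_wpM2l ?mulr_ge0 ?rnorm_ge0 // gerBl exprn_ge0.
have s_cvg x : exists l : X, s x @ \oo --> l.
  suff : cvg (s x @ \oo) by move=> sx; exists (lim (s x @ \oo)).
  apply: rcauchy_cvg => e e0.
  have [N Ne] : exists N, C * rnorm x * 2^-1 ^+ N < e / 2.
    (* This [N] works since [c / (e / 2) < N + 1 <= 2 ^ N]. *)
    set c := C * rnorm x; exists (Num.trunc (c / (e / 2))).
    rewrite exprVn ltr_pdivrMr ?exprn_gt0 // mulrC -ltr_pdivrMr ?divr_gt0 //.
    by apply: (lt_le_trans (truncnS_gt _)); rewrite -natrX ler_nat ltn_expl.
  exists N => m n Nm Nn; have -> : s x m - s x n = (s x m - s x N) - (s x n - s x N).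
    by rewrite opprB addrA subrK.
  apply: (le_lt_trans (ler_rnormD _ _)); rewrite rnormN.
  by have := s_tail_le x N m Nm; have := s_tail_le x N n Nn; lra.
have [K sK] := choice s_cvg.
have Klin : linear K.
  move=> c x y; apply: (cvg_unique (norm_hausdorff (V := X)) (sK _)).
  have -> : s (c *: x + y) = (fun n => c *: s x n) \+ s y.
    apply/funext => n; rewrite /s /= scaler_sumr -big_split /=.
    by apply: eq_bigr => j _; rewrite linearP.
  by apply: cvgD; [exact: cvgZr|exact: sK].
pose KL : {linear X -> X} := HB.pack K (GRing.isLinear.Build _ _ _ _ K Klin).
exists KL; split=> [x|x k hx].
  apply/ler_addgt0Pl => e e0; have [N sN] := (rcvgP _ _).1 (sK x) e e0.
  have -> : KL x = s x N - (s x N - K x) by rewrite subKr.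
  apply: (le_trans (ler_rnormD _ _)); rewrite rnormN addrC lerD ?(ltW (sN _ _)) //.
  have := s_tail_le x 0%N N isT; rewrite /s big_ord0 subr0 expr0 mulr1.
  exact.
apply: (cvg_unique (norm_hausdorff (V := X)) (sK _)); apply/rcvgP => e e0.
exists k => n kn; rewrite /s -(subnKC kn) big_split_ord /= [X in _ + X - _]big1 => [|j _].
  by rewrite addr0 subrr rnorm0.
by rewrite hx // leq_addr.
Qed.

(** [S] is already strictly triangular, but some coefficients just below the top may vanish. The
    rank-one term [eps j * f j.+1 x] along [u j] kills [u k] for [j >= k], so triangularity
    survives, and for [j = k - 1] it adds exactly [eps j]. *)
Lemma shift_perturbation u (S : {linear X -> X}) (e : R) : 0 < e ->
  (forall k, ~ prefix_span u k (u k)) -> (forall k, prefix_span u k (S (u k))) ->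
  exists K : {linear X -> X}, (forall x, rnorm (K x) <= e * rnorm x) /\
    exists a : nat -> nat -> R[i], forall k,
      S (u k) + K (u k) = \sum_(i < k) a k i *: u i /\
      ((0 < k)%N -> a k k.-1 != 0).
Proof.
move=> e0 u_ind Su.
have /choice [f fP] : forall k, exists f : {scalar X},
    [/\ exists M : R, forall x, complex.Re `|f x| <= M * rnorm x,
      forall x, prefix_span u k x -> f x = 0 & f (u k) = 1].
  by move=> k; exact: dual_functional.
have /choice [M fM] : forall k, exists M : R, 0 <= M /\
    forall x, complex.Re `|f k x| <= M * rnorm x.
  move=> k; have [[M fM] _ _] := fP k; exists `|M|; split=> // x.
  by apply: (le_trans (fM x)); rewrite ler_wpM2r ?rnorm_ge0 // ler_norm.
have /choice [a aP] := Su.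
(* Small enough for the [j]-th term to have norm at most [e * 2^-(j + 1)]; the added 1s keep the
   denominator positive. *)
pose d j : R := e * 2^-1 ^+ j.+1 / ((1 + M j.+1) * (1 + rnorm (u j))).
have d0 j : 0 < d j.
  have [M0 _] := fM j.+1; have := rnorm_ge0 (u j) => u0.
  by rewrite divr_gt0 ?mulr_gt0 ?exprn_gt0 ?ltr_pwDl.
(* Correcting only the zero coefficients ensures that no nonzero one is cancelled. *)
pose eps j : R[i] := if a j.+1 j == 0 then (d j)%:C else 0.
have eps_le j : complex.Re `|eps j| <= d j.
  rewrite /eps; case: ifP => _; last by rewrite normr0 /= ltW.
  by rewrite ger0_norm ?ler0c ?(ltW (d0 j)) /=.
pose h0 j x := (eps j * f j.+1 x) *: u j.
have hlin j : linear (h0 j).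
  by move=> c x y; rewrite /h0 linearP /= mulrDr scalerDl scalerA mulrCA.
pose h j : {linear X -> X} :=
  HB.pack (h0 j) (GRing.isLinear.Build _ _ _ _ (h0 j) (hlin j)).
have [|j x|K [Ke KE]] := @exists_sum_operator h e; first exact: ltW.
  rewrite -[h j x]/(h0 j x) /h0 rnormZ Re_normM.
  have [M0 fMx] := fM j.+1.
  have D0 : 0 < (1 + M j.+1) * (1 + rnorm (u j)).
    by rewrite mulr_gt0 ?ltr_pwDl ?rnorm_ge0.
  apply: (@le_trans _ _ (d j * (M j.+1 * rnorm x) * rnorm (u j))).
    rewrite ler_wpM2r ?rnorm_ge0 // ler_pM ?Re_norm_ge0 //.
  have -> : d j * (M j.+1 * rnorm x) * rnorm (u j) =
      d j * (M j.+1 * rnorm (u j)) * rnorm x by ring.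
  rewrite ler_wpM2r ?rnorm_ge0 //.
  have -> : e * 2^-1 ^+ j.+1 = d j * ((1 + M j.+1) * (1 + rnorm (u j))).
    by rewrite /d divfK // gt_eqF.
  by rewrite ler_wpM2l ?(ltW (d0 _)) // ler_pM ?rnorm_ge0 // lerDr.
exists K; split=> //; exists (fun k i => a k i + eps i * f i.+1 (u k)) => k; split.
  rewrite aP (KE _ k) => [|j kj]; last first.
    have [_ f0 _] := fP j.+1.
    by rewrite -[h j _]/(h0 j _) /h0 f0 ?mulr0 ?scale0r //; apply: mem_prefix_span.
  by rewrite -big_split /=; apply: eq_bigr => i _; rewrite scalerDl.
case: k => // k _ /=; have [_ _ ->] := fP k.+1; rewrite mulr1 /eps.
have [->|ak] := eqVneq (a k.+1 k) 0; last by rewrite addr0.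
by rewrite add0r gt_eqF // ltcR.
Qed.

End Perturbation.

(** * Mixing *)

Section BinomialChain.
Context {K : fieldType} {V : lmodType K}.

(** [B] maps [E (k + 1)] onto [E k], by triangular solving from the top coefficient down. *)
Lemma prefix_span_shift_surj (u : nat -> V) (a : nat -> nat -> K) (B : {linear V -> V}) :
  (forall k, B (u k) = \sum_(i < k) a k i *: u i /\ ((0 < k)%N -> a k k.-1 != 0)) ->
  forall k y, prefix_span u k y -> exists r, prefix_span u k.+1 r /\ B r = y.
Proof.
move=> Bu; elim=> [y [c ->]|k IHk y /prefix_spanS [c yc]].
  by exists 0; rewrite linear0 big_ord0; split=> //; exact: prefix_span0.
(* This [d] makes the [u k] component of [d *: B (u k.+1)] equal to that of [y]. *)
have [Bk /(_ isT) /= ak] := Bu k.+1; pose d := c / a k.+1 k.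
have [|r [ru Br]] := IHk (y - d *: B (u k.+1)).
  have -> : y - d *: B (u k.+1) = y - c *: u k - d *: \sum_(i < k) a k.+1 i *: u i.
    by rewrite Bk big_ord_recr /= scalerDr scalerA divfK // opprD addrA addrAC.
  apply: prefix_spanB => //; apply: prefix_spanZ; apply: prefix_span_sum => i _.
  by apply: prefix_spanZ; exact: mem_prefix_span.
exists (r + d *: u k.+1); split.
  apply: prefix_spanD; first exact: prefix_span_le ru.
  by apply: prefix_spanZ; exact: mem_prefix_span.
by rewrite linearD Br (linearZ_LR B) subrK.
Qed.

(** Recursion in which each value depends on the list of all earlier ones, as the binomial sums
    require. *)
Lemma exists_course_of_values (G : seq V -> V) :
  exists w : nat -> V, forall k, w k = G (mkseq w k).
Proof.
pose L := fix L n := if n is n'.+1 then rcons (L n') (G (L n')) else [::].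
exists (fun k => G (L k)) => k; congr G.
by elim: k => // k IHk; rewrite mkseqS -IHk.
Qed.

(** The relation says that [lambda + B] acts on the [w k] as [lambda] times the translation by 1
    acts on the powers of ['X]. Each [w k] is solved for recursively, the right-hand side being in
    [E k]. *)
Lemma exists_binomial_chain (u : nat -> V) (a : nat -> nat -> K)
    (B : {linear V -> V}) (lambda : K) :
  [pchar K] =i pred0 -> lambda != 0 -> u 0%N != 0 ->
  (forall k, B (u k) = \sum_(i < k) a k i *: u i /\ ((0 < k)%N -> a k k.-1 != 0)) ->
  exists w : nat -> V,
    (forall k, B (w k) = lambda *: \sum_(j < k) 'C(k, j)%:R *: w j) /\
    forall k, prefix_span u k `<=` prefix_span w k.
Proof.
move=> K0 lambda0 u0 Bu.
pose rhs (l : seq V) := lambda *: \sum_(j < size l) 'C(size l, j)%:R *: nth 0 l j.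
(* The hypothesis sits under the existential, so that [G] is total, with value 0 on unsuitable
   lists. The last clause excludes the trivial solution [r = 0] at the start. *)
have /choice [G GP] : forall l : seq V, exists r,
    (forall j, (j < size l)%N -> prefix_span u j.+1 (nth 0 l j)) ->
    [/\ prefix_span u (size l).+1 r, B r = rhs l & size l = 0%N -> r = u 0%N].
  move=> l; have [lu|] :=
    pselect (forall j, (j < size l)%N -> prefix_span u j.+1 (nth 0 l j)); last by exists 0.
  have [l0|l0] := eqVneq (size l) 0%N.
    exists (u 0%N) => _; split=> //; first by apply: mem_prefix_span.
    by rewrite (Bu 0%N).1 /rhs l0 !big_ord0 scaler0.
  have [|r [ru Br]] := prefix_span_shift_surj Bu (k := size l) (y := rhs l).
    apply: prefix_spanZ; apply: prefix_span_sum => j _; apply: prefix_spanZ.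
    by apply: (prefix_span_le (n := j.+1)) => //; exact: lu.
  by exists r => _; split=> // /eqP; rewrite (negbTE l0).
have [w wG] := exists_course_of_values G; exists w.
have wP k : [/\ prefix_span u k.+1 (w k),
    B (w k) = lambda *: \sum_(j < k) 'C(k, j)%:R *: w j & k = 0%N -> w k = u 0%N].
  elim/ltn_ind: k => k IHk; have [|] := GP (mkseq w k).
    by rewrite size_mkseq => j jk; rewrite nth_mkseq //; case: (IHk j jk).
  rewrite -wG /rhs size_mkseq => wu Bw w0; split=> //; rewrite Bw; congr (_ *: _).
  by apply: eq_bigr => j _; rewrite nth_mkseq.
(* If [w (k + 1)] were in [E (k + 1)], applying [B] would put [w k] in [E k]. *)
have w_new k : ~ prefix_span u k (w k).
  elim: k => [[c]|k IHk wu].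
    by have [_ _ ->] := wP 0%N; rewrite // big_ord0; exact/eqP.
  have Bwu : prefix_span u k (B (w k.+1)).
    apply: image_prefix_span wu => i ik; rewrite (Bu i).1.
    apply: prefix_span_sum => j _; apply: prefix_spanZ; apply: mem_prefix_span.
    exact: leq_trans (ltn_ord j) _.
  apply: IHk.
  have [_ Bw _] := wP k.+1.
  have -> : w k = k.+1%:R^-1 *:
      (lambda^-1 *: B (w k.+1) - \sum_(j < k) 'C(k.+1, j)%:R *: w j).
    rewrite Bw big_ord_recr /= scalerA mulVf // scale1r addrAC subrr add0r.
    by rewrite scalerA binSn mulVf ?scale1r // ((pcharf0P K).1 K0).
  apply: prefix_spanZ; apply: prefix_spanB; first exact: prefix_spanZ.
  apply: prefix_span_sum => j _; apply: prefix_spanZ.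
  by have [wj _ _] := wP j; exact: prefix_span_le wj.
split=> [k|]; first by case: (wP k).
elim=> [_ [c ->]|k IHk]; first by rewrite big_ord0; exact: prefix_span0.
move=> x /prefix_spanS [c xu]; rewrite -(subrK (c *: u k) x).
apply: prefix_spanD; first exact: prefix_span_le (IHk _ xu).
apply: prefix_spanZ; have [/prefix_spanS [b wb] _ _] := wP k.
(* Modulo [E k] the vector [w k] is [b *: u k]; with [b] invertible, [u k] is recovered from [w k]
   and earlier vectors. *)
have b0 : b != 0.
  by apply/eqP => b0; apply: (w_new k); rewrite -[w k]subr0 -(scale0r (u k)) -b0.
have -> : u k = b^-1 *: (w k - (w k - b *: u k)).
  by rewrite subKr scalerA mulVf // scale1r.
apply: prefix_spanZ; apply: prefix_spanB; first exact: mem_prefix_span.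
exact: prefix_span_le (IHk _ wb).
Qed.

(** The linear map [Phi] that sends ['X^k] to [w k]. *)
Definition poly_comb (w : nat -> V) (p : {poly K}) : V :=
  \sum_(i < size p) p`_i *: w i.

Lemma poly_combE w n (p : {poly K}) : (size p <= n)%N ->
  poly_comb w p = \sum_(i < n) p`_i *: w i.
Proof.
move=> pn; rewrite -(subnKC pn) big_split_ord /= [X in _ = _ + X]big1 ?addr0 // => i _.
by rewrite nth_default ?scale0r // leq_addr.
Qed.

Lemma poly_comb_linear w : linear (poly_comb w).
Proof.
move=> c p q; pose n := maxn (size (c *: p + q)) (maxn (size p) (size q)).
rewrite !(@poly_combE w n) ?leq_maxr ?leq_maxl //; last first.
- by rewrite !leq_max leqnn orbT.
- by rewrite !leq_max leqnn !orbT.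
rewrite scaler_sumr -big_split /=; apply: eq_bigr => i _.
by rewrite coefD coefZ scalerDl scalerA.
Qed.

HB.instance Definition _ w :=
  GRing.isLinear.Build K {poly K} V _ (poly_comb w) (poly_comb_linear w).

Lemma poly_combXn w k : poly_comb w 'X^k = w k.
Proof.
rewrite (@poly_combE w k.+1) ?size_polyXn // big_ord_recr /= coefXn eqxx scale1r.
rewrite big1 ?add0r // => i _; rewrite coefXn (ltn_eqF (ltn_ord i)) scale0r //.
Qed.

(** The binomial expansion of [('X + 1)^k] gives one step; iterated translations by 1 add up to a
    translation by [m]. *)
Lemma iter_poly_comb w (lambda : K) (T : {linear V -> V}) :
  (forall k, T (w k) = lambda *: \sum_(j < k.+1) 'C(k, j)%:R *: w j) ->
  forall m p, iter m T (poly_comb w p) =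
    lambda ^+ m *: poly_comb w (p \Po ('X + (m%:R)%:P)).
Proof.
move=> Tw.
have Tp p : T (poly_comb w p) = lambda *: poly_comb w (p \Po ('X + 1)).
  rewrite comp_polyE (linear_sum (poly_comb w)) scaler_sumr.
  rewrite [in LHS]/poly_comb (linear_sum T).
  apply: eq_bigr => i _; rewrite (linearZ_LR T) Tw (linearZ_LR (poly_comb w)).
  rewrite [LHS]scalerA [RHS]scalerA [in RHS]mulrC; congr (_ *: _).
  rewrite addrC exprDn (linear_sum (poly_comb w)); apply: eq_bigr => j _.
  by rewrite expr1n mul1r -scaler_nat (linearZ_LR (poly_comb w)) /= poly_combXn.
elim=> [p|m IHm p]; first by rewrite /= expr0 scale1r addr0 comp_polyXr.
rewrite iterS IHm (linearZ_LR T) Tp scalerA -exprSr -comp_polyA.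
by rewrite comp_polyD comp_polyX comp_polyC -natr1 polyCD addrAC addrA.
Qed.

End BinomialChain.

(** * Decay estimates and mixing of scalar plus shift *)

Section Mixing.
Context {R : realType} {X : normedModType R[i]}.
Implicit Types (s : nat -> X) (v x y : X).

Definition decays s : Prop :=
  exists C : R, forall m, (0 < m)%N -> rnorm (s m) <= C / m%:R.

Lemma decaysD s s' : decays s -> decays s' -> decays (fun m => s m + s' m).
Proof.
move=> [C sC] [C' sC']; exists (C + C') => m m0; rewrite mulrDl.
by apply: (le_trans (ler_rnormD _ _)); rewrite lerD ?sC ?sC'.
Qed.

Lemma decays_sum (I : Type) (r : seq I) (F : I -> nat -> X) :
  (forall i, decays (F i)) -> decays (fun m => \sum_(i <- r) F i m).
Proof.
move=> Fd; elim: r => [|i r IHr].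
  by exists 0 => m _; rewrite big_nil rnorm0 mul0r.
by under eq_fun do rewrite big_cons; exact: decaysD.
Qed.

Lemma decaysZ (c : nat -> R[i]) v :
  (forall m, (0 < m)%N -> complex.Re `|c m| <= m%:R^-1) ->
  decays (fun m => c m *: v).
Proof.
move=> cm; exists (rnorm v) => m /cm c_le; rewrite rnormZ mulrC.
by rewrite ler_wpM2l ?rnorm_ge0.
Qed.

Lemma decays_near (s : nat -> X) x (U : set X) : open U -> U x ->
  decays (fun m => s m - x) -> exists N, forall m, (N < m)%N -> U (s m).
Proof.
move=> Uo Ux [C sC]; have [e e0 eU] := open_rball Uo Ux.
exists (Num.trunc (C / e)) => m Nm; apply: eU.
have m0 : (0 < m)%N by exact: leq_ltn_trans Nm.
apply: (le_lt_trans (sC m m0)); rewrite ltr_pdivrMr ?ltr0n // mulrC -ltr_pdivrMr //.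
by apply: (lt_le_trans (truncnS_gt _)); rewrite ler_nat.
Qed.

(** Expanding the translate produces powers [c ^ j] with [j <= deg p < n], so division by [m ^ n]
    leaves at least one factor [1 / m]. *)
Lemma decays_poly_shift (Phi : {linear {poly R[i]} -> X}) (n : nat) (p : {poly R[i]})
    (theta c : nat -> R[i]) : (size p <= n)%N ->
  (forall m, complex.Re `|theta m| = 1) -> (forall m, complex.Re `|c m| = m%:R) ->
  decays (fun m => Phi ((theta m / m%:R ^+ n) *: ((p \Po ('X + (c m)%:P)) * 'X^n))).
Proof.
move=> pn theta1 cm.
pose k m := theta m / m%:R ^+ n.
pose v (i j : nat) : {poly R[i]} := p`_i *: ('X^(i - j) * 'X^n) *+ 'C(i, j).
have E m : k m *: ((p \Po ('X + (c m)%:P)) * 'X^n) =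
    \sum_(i < size p) \sum_(j < i.+1) (k m * c m ^+ j) *: v i j.
  rewrite comp_polyE mulr_suml scaler_sumr; apply: eq_bigr => i _.
  rewrite exprDn scaler_sumr mulr_suml scaler_sumr; apply: eq_bigr => j _.
  rewrite -polyC_exp /v; move: (k m) 'X^(i - j) 'X^n (c m ^+ j) => b A B d.
  rewrite (mulrC A) mul_polyC !scalerMnr -!scalerAl mulrnAl.
  by rewrite [LHS]scalerA [LHS]scalerA [RHS]scalerA mulrAC.
have -> : (fun m => Phi (k m *: ((p \Po ('X + (c m)%:P)) * 'X^n))) =
    (fun m => \sum_(i < size p) \sum_(j < i.+1) (k m * c m ^+ j) *: Phi (v i j)).
  apply/funext => m; rewrite E (linear_sum Phi); apply: eq_bigr => i _.
  by rewrite (linear_sum Phi); apply: eq_bigr => j _; exact: linearZ_LR.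
apply: decays_sum => i; apply: decays_sum => j; apply: decaysZ => m m0.
rewrite /k !Re_normM Re_normV !Re_normXn Re_norm_nat theta1 cm mul1r.
have m0' : (0 : R) < m%:R by rewrite ltr0n.
have jn : (j < n)%N.
  by apply: leq_trans pn; apply: leq_trans (ltn_ord i); rewrite ltnS -ltnS.
rewrite mulrC ler_pdivrMr ?exprn_gt0 // -ler_pdivrMl ?invr_gt0 // invrK -exprS.
by rewrite ler_weXn2l // ler1n.
Qed.

(** In the binomial expansion the constant term gives [Phi p], and every other term carries a
    positive power of [c m]. *)
Lemma decays_poly_factor (Phi : {linear {poly R[i]} -> X}) (n : nat) (p : {poly R[i]})
    (c : nat -> R[i]) : (forall m, complex.Re `|c m| = m%:R^-1) ->
  decays (fun m => Phi (p * (1 + c m *: 'X) ^+ n) - Phi p).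
Proof.
move=> cm.
have -> : (fun m => Phi (p * (1 + c m *: 'X) ^+ n) - Phi p) =
    (fun m => \sum_(j < n) c m ^+ j.+1 *: Phi (p * 'X^(j.+1) *+ 'C(n, j.+1))).
  apply/funext => m; rewrite exprDn big_ord_recl /= bin0 expr0 expr1n mulr1.
  rewrite mulrDr mulr1 linearD addrC addKr mulr_sumr (linear_sum Phi).
  apply: eq_bigr => j _; rewrite -(linearZ_LR Phi) expr1n mul1r exprZn.
  by rewrite -scalerMnr !mulrnAr -scalerAr.
apply: decays_sum => j; apply: decaysZ => m m0; rewrite Re_normXn cm exprS.
by rewrite ler_piMr ?invr_ge0 // exprn_ile1 ?invr_ge0 // invf_le1 ?ltr0n // ler1n.
Qed.

Lemma scalar_plus_shift_mixing (T B : {linear X -> X}) (lambda : R[i]) :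
  `|lambda| = 1 -> (forall x, T x = lambda *: x + B x) ->
  generalised_backward_1_shift B -> mixing T.
Proof.
move=> lambda1 TE [_ [u [u_ind u_dense [a Bu]]]] U V Uo Vo [x0 Ux0] [y0 Vy0].
have lambda0 : lambda != 0.
  by rewrite -normr_eq0 lambda1 oner_eq0.
have u0 : u 0%N != 0.
  apply/eqP => u0; have := u_ind 1%N (fun=> 1).
  by rewrite big_ord1 u0 scaler0 => /(_ erefl ord0)/eqP; rewrite oner_eq0.
have [w [Bw uw]] := exists_binomial_chain (pchar_num _) lambda0 u0 Bu.
have Tw k : T (w k) = lambda *: \sum_(j < k.+1) 'C(k, j)%:R *: w j.
  by rewrite big_ord_recr /= binn scale1r scalerDr -Bw TE addrC.
(* The [w k] span all the [u k], so the range of [Phi] is dense and both open sets contain images of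
   polynomials. *)
pose Phi : {linear {poly R[i]} -> X} := poly_comb w.
have PhiD W z : open W -> W z -> exists p, W (Phi p).
  move=> Wo Wz; have [|x [Wx /linear_span_prefix_span [k xu]]] := u_dense W _ Wo.
    by exists z.
  have [c xE] := uw k x xu; exists (\sum_(i < k) c i *: 'X^i).
  suff <- : x = Phi (\sum_(i < k) c i *: 'X^i) by [].
  rewrite xE (linear_sum Phi); apply: eq_bigr => i _.
  by rewrite (linearZ_LR Phi) /= poly_combXn.
have [p Up] := PhiD U x0 Uo Ux0; have [q Vq] := PhiD V y0 Vo Vy0.
pose n := maxn (size p) (size q).
have lambda_norm m : complex.Re `|lambda ^+ m| = 1 by rewrite Re_normXn lambda1 expr1n.
(* Translation by [m] turns [1 - 'X / m] into [- 'X / m], which makes the [p] term small, and turns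
   ['X / m] into [1 + 'X / m], which brings the [q] term near [q]. *)
pose P m := p * (1 + - m%:R^-1 *: 'X) ^+ n +
  ((lambda ^+ m)^-1 / m%:R ^+ n) *: ((q \Po ('X + (- m%:R)%:P)) * 'X^n).
have P_lim : decays (fun m => Phi (P m) - Phi p).
  have -> : (fun m => Phi (P m) - Phi p) = (fun m =>
      (Phi (p * (1 + - m%:R^-1 *: 'X) ^+ n) - Phi p) +
      Phi (((lambda ^+ m)^-1 / m%:R ^+ n) *: ((q \Po ('X + (- m%:R)%:P)) * 'X^n))).
    by apply/funext => m; rewrite /P linearD addrAC.
  apply: decaysD.
    apply: (@decays_poly_factor Phi n p (fun m => - m%:R^-1)) => m.
    by rewrite normrN Re_normV Re_norm_nat.
  apply: (@decays_poly_shift Phi n q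
    (fun m => (lambda ^+ m)^-1) (fun m => - m%:R)) => [|m|m].
  - by rewrite leq_maxr.
  - by rewrite Re_normV lambda_norm invr1.
  - by rewrite normrN Re_norm_nat.
(* The value of [T^m (Phi (P m))]; the sign comes from [(- 'X / m)^n]. *)
pose Q m := Phi (((-1) ^+ n * lambda ^+ m / m%:R ^+ n) *:
    ((p \Po ('X + (m%:R)%:P)) * 'X^n)) + Phi (q * (1 + m%:R^-1 *: 'X) ^+ n).
have TP m : (0 < m)%N -> iter m T (Phi (P m)) = Q m.
  move=> m0; have m0' : m%:R != 0 :> R[i] by rewrite pnatr_eq0 -lt0n.
  have lm0 : lambda ^+ m != 0 by rewrite expf_neq0.
  rewrite /Phi (iter_poly_comb Tw) -(linearZ_LR Phi) /Q -linearD; congr (Phi _).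
  rewrite /P comp_polyD comp_polyM comp_polyZ comp_polyM -comp_polyA.
  have -> : ('X + (- m%:R)%:P) \Po ('X + (m%:R)%:P) = 'X :> {poly R[i]}.
    by rewrite comp_polyD comp_polyX comp_polyC -addrA -polyCD addrN addr0.
  have -> : (1 + - m%:R^-1 *: 'X) ^+ n \Po ('X + (m%:R)%:P) =
      ((-1) ^+ n / m%:R ^+ n) *: 'X^n :> {poly R[i]}.
    rewrite (rmorphXn (comp_poly _)) /= comp_polyD comp_polyZ comp_polyX rmorph1.
    rewrite scalerDr -[_ *: m%:R%:P]mul_polyC -polyCM mulNr mulVf // polyCN.
    by rewrite addrCA subrr addr0 exprZn [in LHS]exprNn exprVn.
  have -> : 'X^n \Po ('X + (m%:R)%:P) =
      m%:R ^+ n *: (1 + m%:R^-1 *: 'X) ^+ n :> {poly R[i]}.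
    rewrite (rmorphXn (comp_poly _)) /= comp_polyX -exprZn scalerDr scalerA divff //.
    by rewrite scale1r alg_polyC addrC.
  rewrite comp_polyXr scalerDr; congr (_ + _).
    by rewrite -scalerAr scalerA mulrA [lambda ^+ m * _]mulrC.
  rewrite -scalerAr !scalerA mulrA divff // mul1r mulVf ?expf_neq0 //.
  by rewrite scale1r.
have Q_lim : decays (fun m => Q m - Phi q).
  have -> : (fun m => Q m - Phi q) = (fun m =>
      Phi (((-1) ^+ n * lambda ^+ m / m%:R ^+ n) *:
        ((p \Po ('X + (m%:R)%:P)) * 'X^n)) +
      (Phi (q * (1 + m%:R^-1 *: 'X) ^+ n) - Phi q)).
    by apply/funext => m; rewrite /Q addrA.
  apply: decaysD; last first.
    apply: (@decays_poly_factor Phi n q (fun m => m%:R^-1)) => m.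
    by rewrite Re_normV Re_norm_nat.
  apply: (@decays_poly_shift Phi n p
    (fun m => (-1) ^+ n * lambda ^+ m) (fun m => m%:R)) => [|m|m].
  - by rewrite leq_maxl.
  - by rewrite Re_normM lambda_norm Re_normXn normrN normr1 expr1n mulr1.
  - exact: Re_norm_nat.
have [N PN] := decays_near Uo Up P_lim; have [N' QN] := decays_near Vo Vq Q_lim.
exists (maxn N N') => m; rewrite gtn_max => /andP[Nm N'm].
exists (Q m); split; last exact: QN.
by exists (Phi (P m)); [exact: PN|rewrite TP // (leq_ltn_trans _ N'm)].
Qed.

End Mixing.

(** * Approximation in the operator norm *)

Lemma operator_norm_le (R : realType) (X : normedModType R[i]) (T : X -> X) (C : R) :
  0 <= C -> (forall x, rnorm (T x) <= C * rnorm x) -> operator_norm T <= C.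
Proof.
move=> C0 TC; apply: ge_sup => [|_ [x /= x1 <-]].
  by exists (rnorm (T 0)), 0 => //=; rewrite normr0 ler01.
by apply: (le_trans (TC x)); rewrite ler_piMr // -lecR -rnormE.
Qed.

(** The pointwise bound on [S - B] serves both conclusions, since adding the same scalar operator to
    both leaves the difference unchanged. *)
Lemma shift_approximation (R : realType) (X : completeNormedModType R[i])
    (S : {linear X -> X}) : separable_space X -> infinite_dimensional X ->
  bounded_operator S -> dense (generalised_kernel S) ->
  forall e : R, 0 < e -> exists B : {linear X -> X},
    [/\ bounded_operator B, generalised_backward_1_shift B &
      forall x, rnorm (S x - B x) <= e * rnorm x].
Proof.
move=> Xsep Xinf Sb Sd e e0.
have [u [u_ind Su u_dense]] := exists_triangular_basis Xsep Xinf Sd.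
have [K [Ke [a Ka]]] := shift_perturbation e0 u_ind Su.
have Bb : bounded_operator (S \+ K).
  move/bounded_operatorP: Sb => [M M0 SM]; apply/bounded_operatorP.
  exists (M + e) => [|x]; first by rewrite addr_ge0 // ltW.
  by apply: (le_trans (ler_rnormD _ _)); rewrite mulrDl lerD.
exists (S \+ K); split=> [//||x]; last first.
  by rewrite /= opprD addrA subrr add0r rnormN.
split=> //; exists u; split=> //; first exact: linearly_independent_prefix.
by exists a.
Qed.

Theorem theorem3p1 (R : realType) (X : completeNormedModType R[i])
    (X_separable : separable_space X) (X_infdim : infinite_dimensional X)
    (S : {linear X -> X}) (S_bounded : bounded_operator S)
    (S_kernel : dense (generalised_kernel S)) :
  operator_norm_closure generalised_backward_1_shift S /\
  forall lambda : R[i], `|lambda| = 1 ->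
    operator_norm_closure mixing_operator (lambda \*: idfun \+ S).
Proof.
have approx := shift_approximation X_separable X_infdim S_bounded S_kernel.
split=> [|lambda lambda1].
  split=> // e e0; have e2 : 0 < e / 2 by rewrite divr_gt0.
  have [B [Bb Bshift SB]] := approx (e / 2) e2.
  (* [operator_norm_le] gives a weak inequality; halving [e] makes it strict. *)
  exists B; split=> //; apply: (@le_lt_trans _ _ (e / 2)); last by lra.
  by apply: operator_norm_le => //; exact: ltW.
have plus_bounded (T : {linear X -> X}) : bounded_operator T ->
    bounded_operator (lambda \*: idfun \+ T).
  move=> /bounded_operatorP [M M0 TM]; apply/bounded_operatorP.
  exists (1 + M) => [|x]; first by rewrite addr_ge0.
  apply: (le_trans (ler_rnormD _ _)); rewrite mulrDl lerD //.
  by rewrite rnormZ lambda1.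
split; first exact: plus_bounded.
move=> e e0; have e2 : 0 < e / 2 by rewrite divr_gt0.
have [B [Bb Bshift SB]] := approx (e / 2) e2.
exists (lambda \*: idfun \+ B); split; first exact: plus_bounded.
  split; first exact: plus_bounded.
  exact: scalar_plus_shift_mixing lambda1 _ Bshift.
apply: (@le_lt_trans _ _ (e / 2)); last by lra.
apply: operator_norm_le => [|x]; first exact: ltW.
by rewrite /= opprD addrACA subrr add0r.
Qed.
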